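(* Fix $s,t\in X_2$. There exists a $\mu$-null set $N(s,t)\subset\Omega$ such that for every $\omega\in\Omega\setminus N(s,t)$, $$|M_\infty(s,t;\omega)|^2\le h(s;\omega)\,h(t;\omega).$$
   Context: Let $X$ be a set, $m\ge1$ an integer, and $\varphi_1,\dots,\varphi_m:X\to X$ maps. A kernel $J:Y\times Y\to\mathbb{C}$ is positive definite if $\sum_{\alpha,\beta}\overline{c_\alpha}c_\beta J(s_\alpha,s_\beta)\ge0$ for all finite families $(c_\alpha,s_\alpha)\in\mathbb{C}\times Y$; $J_1\le J_2$ means that $J_2-J_1$ is positive definite. The pullback operator is $(LJ)(s,t):=\sum_{i=1}^m J(\varphi_i(s),\varphi_i(t))$. Fix a positive definite kernel $K$ on $X$ with $LK\ge K$. Set $K_0:=K$, $K_{n+1}:=LK_n$, $u_n(s):=K_n(s,s)$ (nondecreasing in $n$), $u_\infty(s):=\lim_nu_n(s)\in[0,\infty]$, $X_{\mathrm{fin}}:=\{s\in X:u_\infty(s)<\infty\}$. Each $\varphi_i$ maps $X_{\mathrm{fin}}$ into itself. For $s,t\in X_{\mathrm{fin}}$ the limit $K_\infty(s,t):=\lim_nK_n(s,t)$ exists; $K_\infty$ is positive definite on $X_{\mathrm{fin}}$ and $LK_\infty=K_\infty$ there; $K_\infty(s,s)=u_\infty(s)$. Words: $W_n:=\{1,\dots,m\}^n$, $W_0=\{\emptyset\}$; for $w=i_1\cdots i_n\in W_n$, $\varphi_w:=\varphi_{i_n}\circ\cdots\circ\varphi_{i_1}$ ($\varphi_\emptyset=\mathrm{id}$).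 $\Omega:=\{1,\dots,m\}^{\mathbb{N}}$ with product $\sigma$-algebra and product probability measure $\mu$ making the coordinates independent and uniform on $\{1,\dots,m\}$. For $\omega=\omega_1\omega_2\cdots\in\Omega$, $\omega|n:=\omega_1\cdots\omega_n\in W_n$ ($\omega|0=\emptyset$). For $s,t\in X_{\mathrm{fin}}$, $M_n(s,t;\omega):=m^nK_\infty(\varphi_{\omega|n}(s),\varphi_{\omega|n}(t))$. For $s\in X_{\mathrm{fin}}$ let $B(s):=\sup_{n\ge0}\{m^n\sum_{w\in W_n}u_\infty(\varphi_w(s))^2\}\in[0,\infty]$, and $X_2:=\{s\in X_{\mathrm{fin}}:B(s)<\infty\}$. For $s,t\in X_2$, $M_n(s,t;\cdot)$ converges in $L^2(\Omega,\mu)$ and $\mu$-almost surely; $M_\infty(s,t;\cdot)\in L^2(\Omega,\mu)$ denotes (a fixed measurable version of) the limit, with $M_\infty(s,s;\cdot)\ge0$. The diagonal boundary factor is $h(s;\omega):=M_\infty(s,s;\omega)\in[0,\infty)$. *)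

(* Defs.v *)
From HB Require Import structures.
From mathcomp Require Import all_boot all_order all_algebra.
From mathcomp Require Import all_classical all_reals all_analysis.
From mathcomp Require Import complex.

Set Implicit Arguments.
Unset Strict Implicit.
Unset Printing Implicit Defensive.

Import Order.TTheory GRing.Theory Num.Theory.
Import numFieldNormedType.Exports.

Local Open Scope classical_set_scope.
Local Open Scope ring_scope.

(* [R[i]] has no topology of its own in the libraries: it gets the one of the
   norm [`|z|], which is the one every numFieldType carries. *)
HB.instance Definition _ (R : realType) :=
  NormedModule.copy R[i] R[i]^o.

HB.instance Definition _ (n : nat) := isPointed.Build 'I_n.+1 ord0.

Section Kernels.
Variables (R : realType) (X : Type).

(* The order of [R[i]] compares only numbers with the same imaginary part:
   [0 <= z] means that [z] is real and nonnegative. *)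
Definition kernel_posdef (J : X -> X -> R[i]) : Prop :=
  forall (n : nat) (c : 'I_n -> R[i]) (s : 'I_n -> X),
    0 <= \sum_(a < n) \sum_(b < n) (c a)^* * c b * J (s a) (s b).

Definition kernel_le (J1 J2 : X -> X -> R[i]) : Prop :=
  kernel_posdef (fun s t => J2 s t - J1 s t).

End Kernels.

(* The number of maps is [m = p.+1], so that [m >= 1] and the alphabet
   ['I_p.+1] is a pointed type, as measurable spaces are required to be. *)
Section Iteration.
Variables (R : realType) (X : Type) (p : nat).
Variables (phi : 'I_p.+1 -> X -> X) (K : X -> X -> R[i]).

Definition pullback (J : X -> X -> R[i]) : X -> X -> R[i] :=
  fun s t => \sum_i J (phi i s) (phi i t).

Definition iterK (n : nat) : X -> X -> R[i] := iter n pullback K.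

Definition u_ (n : nat) (s : X) : R := complex.Re (iterK n s s).

Definition u_infty (s : X) : \bar R := limn (fun n => (u_ n s)%:E).

Definition X_fin : set X := [set s | (u_infty s < +oo)%E].

(* The limit exists for [s] and [t] in [X_fin]; elsewhere the value may be
   junk. *)
Definition K_infty (s t : X) : R[i] := limn (fun n => iterK n s t).

(* The first letter of the word is applied first. *)
Definition phi_word (w : seq 'I_p.+1) (s : X) : X :=
  foldl (fun x i => phi i x) s w.

Definition Bsup (s : X) : \bar R :=
  ereal_sup (range (fun n : nat =>
    ((p.+1%:R ^+ n)%:E *
      \sum_(w : n.-tuple 'I_p.+1) u_infty (phi_word w s) ^+ 2)%E)).

Definition X_2 : set X := [set s | X_fin s /\ (Bsup s < +oo)%E].

End Iteration.

Section PathSpace.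
Variable p : nat.

Definition coordinate_events : set (set (nat -> 'I_p.+1)) :=
  \bigcup_k preimage_set_system setT (fun w : nat -> 'I_p.+1 => w k) setT.

Definition Omega : Type := g_sigma_algebraType coordinate_events.

HB.instance Definition _ := Measurable.on Omega.

Definition coord_in (k : nat) (A : set 'I_p.+1) : set Omega :=
  [set w | A (w k)].

(* [mu] is the product of uniform measures; such a [mu] is unique, as
   the finite intersections of coordinate events generate the sigma-algebra. *)
Definition coordinates_iid_uniform (R : realType) (mu : probability Omega R)
    : Prop :=
  (forall k (i : 'I_p.+1), mu (coord_in k [set i]) = (p.+1%:R^-1)%:E) /\
  (forall (J : seq nat) (A : nat -> set 'I_p.+1), uniq J ->
     mu (\bigcap_(k in [set` J]) coord_in k (A k)) =
     (\prod_(k <- J) mu (coord_in k (A k)))%E).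

Definition prefix_word (w : Omega) (n : nat) : seq 'I_p.+1 := mkseq w n.

End PathSpace.

Section ComplexL2.
Context {d : measure_display} {T : measurableType d} {R : realType}.
Variable mu : {measure set T -> \bar R}.

Definition cnorm (f : T -> R[i]) : T -> R := fun w => complex.Re `|f w|.

Definition cmeasurable (f : T -> R[i]) : Prop :=
  measurable_fun setT (fun w => complex.Re (f w)) /\
  measurable_fun setT (fun w => complex.Im (f w)).

Definition cL2 (f : T -> R[i]) : Prop :=
  cmeasurable f /\ finite_norm mu 2%:E (cnorm f).

Definition cL2_cvg (f : nat -> T -> R[i]) (g : T -> R[i]) : Prop :=
  'N[mu]_2%:E[EFin \o cnorm (f n \- g)%R]%E @[n --> \oo]
    --> 0%E.

Definition cae_cvg (f : nat -> T -> R[i]) (g : T -> R[i]) : Prop :=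
  {ae mu, forall w, f n w @[n --> \oo] --> g w}.

End ComplexL2.

Section Boundary.
Variables (R : realType) (X : Type) (p : nat).
Variables (phi : 'I_p.+1 -> X -> X) (K : X -> X -> R[i]).

Definition M_ (n : nat) (s t : X) (w : Omega p) : R[i] :=
  p.+1%:R ^+ n *
  K_infty phi K (phi_word phi (prefix_word w n) s)
                (phi_word phi (prefix_word w n) t).

(* [M] is a choice, for all [s] and [t] in [X_2], of a measurable version of
   the limit of [M_ n s t], nonnegative on the diagonal. *)
Definition is_M_infty (mu : probability (Omega p) R)
    (M : X -> X -> Omega p -> R[i]) : Prop :=
  (forall s t, X_2 phi K s -> X_2 phi K t ->
     [/\ cL2 mu (M s t),
         cL2_cvg mu (fun n => M_ n s t) (M s t) &
         cae_cvg mu (fun n => M_ n s t) (M s t)]) /\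
  (forall s, X_2 phi K s -> forall w, 0 <= M s s w).

Definition diag_factor (M : X -> X -> Omega p -> R[i]) (s : X) (w : Omega p)
  : R[i] := M s s w.

End Boundary.

(* Main.v *)
Require Import Defs.
From mathcomp Require Import all_boot all_order all_algebra.
From mathcomp Require Import all_classical all_reals all_analysis.
From mathcomp Require Import complex.
From mathcomp Require Import ring lra.

(** At a fixed path [w], the kernel [M_ n] is a nonnegative multiple of
    [K_infty] evaluated at the images of [s] and [t] under the prefix of [w] of
    length [n].  Hence Cauchy-Schwarz for [K_infty] gives it for [M_ n] at every
    [n] and every path ([M_cauchy_schwarz]); the inequality is a closed
    condition on its three entries ([re_cauchy_schwarz_cvg]), so it survives at
    each path along which the three sequences [M_ n s s], [M_ n s t] and
    [M_ n t t] converge, that is, outside a null set.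

    Cauchy-Schwarz for [K_infty] is inherited in the same way from the positive
    definite iterates [iterK], provided that [iterK n s t] really converges, at
    points of [X_fin] ([iterK_cvg_K_infty]), and that the maps [phi] do not leave
    [X_fin] ([X_fin_phi]).  The convergence rests on polarization: the
    increments of [iterK] are positive definite, so
    [u_n s + u_n t + 2 Re (z iterK n s t)] is nondecreasing and bounded for
    every unimodular [z]; as [u_n s] and [u_n t] converge, taking [z = 1] and
    [z = - i] gives the real and the imaginary parts. *)

Set Implicit Arguments.
Unset Strict Implicit.
Unset Printing Implicit Defensive.

Import Order.TTheory GRing.Theory Num.Theory.
Import numFieldNormedType.Exports.

Local Open Scope classical_set_scope.
Local Open Scope ring_scope.

(** * Positive definite kernels on two points *)

Section PositiveDefinite.
Context {R : realType} {X : Type}.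
Implicit Types (J : X -> X -> R[i]) (s t : X).

Lemma posdef_diag_ge0 J s : kernel_posdef J -> 0 <= J s s.
Proof.
move=> /(_ 1%N (fun=> 1) (fun=> s)).
by rewrite !big_ord1 rmorph1 !mul1r.
Qed.

Lemma posdef_pair J s t (c0 c1 : R[i]) : kernel_posdef J ->
  0 <= c0^* * c0 * J s s + c0^* * c1 * J s t
       + (c1^* * c0 * J t s + c1^* * c1 * J t t).
Proof.
move=> /(_ 2 (fun i => if i == ord0 then c0 else c1)
             (fun i => if i == ord0 then s else t)).
by rewrite !big_ord_recl !big_ord0 !addr0 /=.
Qed.

(** The forms at the coefficients (1, 1) and (1, i) are real, and so are the
    diagonal entries: the first makes the imaginary parts of the two
    off-diagonal entries opposite, the second makes their real parts equal. *)
Lemma posdef_hermitian J s t : kernel_posdef J -> J t s = (J s t)^*.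
Proof.
move=> Jp.
have := posdef_diag_ge0 s Jp; have := posdef_diag_ge0 t Jp.
have := posdef_pair s t 1 1 Jp; have := posdef_pair s t 1 (0 +i* 1)%C Jp.
rewrite !lecE /=.
case: (J s s) (J s t) (J t s) (J t t) => [a a'] [b b'] [c c'] [d d'] /=.
move=> /andP[/eqP + _] /andP[/eqP + _] /andP[/eqP + _] /andP[/eqP + _] /=.
move=> h1 h2 h3 h4.
apply/eqP; rewrite eq_complex /=; apply/andP; split; apply/eqP; lra.
Qed.

(** The form at the coefficients [a + ib] and [c + id], expanded into real
    arithmetic so that each later positivity argument is the choice of four
    reals. *)
Lemma posdef_real_form J s t (a b c d : R) : kernel_posdef J ->
  0 <= (a ^+ 2 + b ^+ 2) * complex.Re (J s s)
       + (c ^+ 2 + d ^+ 2) * complex.Re (J t t)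
       + 2 * ((a * c + b * d) * complex.Re (J s t)
              - (a * d - b * c) * complex.Im (J s t)).
Proof.
move=> Jp.
have := posdef_pair s t (a +i* b)%C (c +i* d)%C Jp.
rewrite (posdef_hermitian s t Jp).
have := posdef_diag_ge0 s Jp; have := posdef_diag_ge0 t Jp.
rewrite !lecE /=.
case: (J s s) (J s t) (J t t) => [x x'] [y y'] [z z'] /=.
move=> /andP[/eqP-> _] /andP[/eqP-> _] /andP[_] /=.
congr (0 <= _); ring.
Qed.

(** Division-free: with [z = J s t], [P = J s s] and [Q = J t t], the
    coefficients [(- z, P)] make the form equal to [P (P Q - |z|^2)], which
    settles [P > 0]; [(Q, - z^* )] settle [Q > 0]; and if both vanish, the form
    at [(1, - z^* )] is [- 2 |z|^2]. *)
Lemma posdef_cauchy_schwarz J s t : kernel_posdef J ->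
  complex.Re (J s t) ^+ 2 + complex.Im (J s t) ^+ 2
    <= complex.Re (J s s) * complex.Re (J t t).
Proof.
move=> Jp.
have := posdef_diag_ge0 s Jp; have := posdef_diag_ge0 t Jp.
rewrite !lecE /= => /andP[_ +] /andP[_ +].
have form a b c d := posdef_real_form s t a b c d Jp.
move: form.
set x := complex.Re (J s t); set y := complex.Im (J s t).
set P := complex.Re (J s s); set Q := complex.Re (J t t) => form Q0 P0.
move: P0; rewrite le_eqVlt => /orP[/eqP P0|P0]; last first.
  have := form (- x) (- y) P 0 => h.
  rewrite -subr_ge0 -(pmulr_rge0 _ P0); lra.
move: Q0; rewrite le_eqVlt => /orP[/eqP Q0|Q0]; last first.
  have := form Q 0 (- x) y => h.
  rewrite -subr_ge0 -(pmulr_rge0 _ Q0); lra.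
have := form 1 0 (- x) y => h.
rewrite -P0 -Q0 in h *; lra.
Qed.

Lemma posdef_pullback p (phi : 'I_p.+1 -> X -> X) J :
  kernel_posdef J -> kernel_posdef (pullback phi J).
Proof.
move=> Jp n c s; rewrite /pullback.
under eq_bigr do under eq_bigr do rewrite mulr_sumr.
under eq_bigr do rewrite exchange_big.
by rewrite exchange_big; apply: sumr_ge0 => i _; exact: Jp.
Qed.

End PositiveDefinite.

(** * Convergence in the complex numbers, componentwise *)

Section ComplexConvergence.
Context {R : realType}.

Lemma cvg_ReImP (z : nat -> R[i]) (l : R[i]) : z @ \oo --> l <->
  (complex.Re (z n) @[n --> \oo] --> complex.Re l /\
   complex.Im (z n) @[n --> \oo] --> complex.Im l).
Proof.
split=> [/cvgrPdist_lt zl|[/cvgrPdist_lt rl /cvgrPdist_lt il]].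
  split; apply/cvgrPdist_lt => e e0.
    have : 0 < (e%:C)%C by rewrite ltcR.
    move=> /zl; apply: filterS => n; rewrite normc_def ltcR; apply: le_lt_trans.
    by rewrite -sqrtr_sqr !raddfB ler_wsqrtr// lerDl sqr_ge0.
  have : 0 < (e%:C)%C by rewrite ltcR.
  move=> /zl; apply: filterS => n; rewrite normc_def ltcR; apply: le_lt_trans.
  by rewrite -sqrtr_sqr !raddfB ler_wsqrtr// lerDr sqr_ge0.
apply/cvgrPdist_lt => e; rewrite ltcE => /andP[/eqP/= Ie Re0].
have h0 : 0 < complex.Re e / 2 by rewrite divr_gt0.
near=> n.
have hr : `|complex.Re l - complex.Re (z n)| < complex.Re e / 2.
  by near: n; exact: rl.
have hi : `|complex.Im l - complex.Im (z n)| < complex.Re e / 2.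
  by near: n; exact: il.
rewrite normc_def ltcE /= Ie eqxx /=.
rewrite -[ltRHS]gtr0_norm// -sqrtr_sqr ltr_sqrt ?exprn_gt0// !raddfB.
move: hr hi; rewrite !ltr_norml => /andP[r1 r2] /andP[i1 i2].
nra.
Unshelve. all: by end_near. Qed.

(** Stated with real and imaginary parts, because the order of [R[i]] only
    compares numbers with equal imaginary parts; in this form the inequality
    passes to limits by continuity of real operations. *)
Definition re_cauchy_schwarz (a b c : R[i]) : Prop :=
  complex.Re b ^+ 2 + complex.Im b ^+ 2 <= complex.Re a * complex.Re c.

Lemma re_cauchy_schwarz_cvg (u v w : nat -> R[i]) (a b c : R[i]) :
  u @ \oo --> a -> v @ \oo --> b -> w @ \oo --> c ->
  (forall n, re_cauchy_schwarz (u n) (v n) (w n)) -> re_cauchy_schwarz a b c.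
Proof.
move=> /cvg_ReImP[ua _] /cvg_ReImP[vr vi] /cvg_ReImP[wc _] cs.
rewrite /re_cauchy_schwarz !expr2; apply: (ler_cvg_to (a := \oo)).
- exact: cvgD (cvgM vr vr) (cvgM vi vi).
- exact: cvgM ua wc.
- near=> n; exact: cs n.
Unshelve. all: by end_near. Qed.
End ComplexConvergence.

(** * The iterated pullbacks and their limit *)

Section Iterates.
Context {R : realType} {X : Type} {p : nat}.
Variables (phi : 'I_p.+1 -> X -> X) (K : X -> X -> R[i]).
Hypothesis K_posdef : kernel_posdef K.
Hypothesis K_sub : kernel_le K (pullback phi K).

Local Notation Kn n := (iterK phi K n).

Lemma iterK_posdef n : kernel_posdef (Kn n).
Proof. by elim: n => //= n IH; exact: posdef_pullback. Qed.

(** The pullback is additive and preserves positive definiteness, so the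
    hypothesis on the first step propagates to every step. *)
Lemma iterK_le_succ n : kernel_le (Kn n) (Kn n.+1).
Proof.
rewrite /kernel_le; elim: n => // n /(posdef_pullback phi); congr kernel_posdef.
by apply/funext => s; apply/funext => t; rewrite /= /pullback -sumrB.
Qed.

Lemma u_ge0 n s : 0 <= u_ phi K n s.
Proof. by have := posdef_diag_ge0 s (iterK_posdef n); rewrite lecE => /andP[]. Qed.

Lemma u_nondecreasing s : nondecreasing_seq (u_ phi K ^~ s).
Proof.
apply/nondecreasing_seqP => n.
have := posdef_diag_ge0 s (iterK_le_succ n).
by rewrite lecE => /andP[_]; rewrite raddfB subr_ge0.
Qed.

Lemma u_inftyE s : u_infty phi K s = ereal_sup (range (fun n => (u_ phi K n s)%:E)).
Proof.
apply/cvg_lim => //; apply: ereal_nondecreasing_cvgn => m n mn.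
by rewrite lee_fin u_nondecreasing.
Qed.

Lemma X_finP s : X_fin phi K s <-> exists b, forall n, u_ phi K n s <= b.
Proof.
rewrite /X_fin /= u_inftyE; split=> [soo|[b ub]]; last first.
  apply: (@le_lt_trans _ _ b%:E); last exact: ltry.
  by apply: ge_ereal_sup => _ [n _ <-]; rewrite lee_fin.
have le n : ((u_ phi K n s)%:E <= ereal_sup (range (fun n => (u_ phi K n s)%:E)))%E.
  by apply: ereal_sup_ubound; exists n.
exists (fine (ereal_sup (range (fun n => (u_ phi K n s)%:E)))) => n.
rewrite -lee_fin fineK// ge0_fin_numE//.
by apply: le_trans (le 0%N); rewrite lee_fin u_ge0.
Qed.

(** [u_{n+1} s] is the sum over [i] of the nonnegative [u_n (phi i s)], so any
    bound for the iterates at [s] is one at [phi i s]. *)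
Lemma X_fin_phi i s : X_fin phi K s -> X_fin phi K (phi i s).
Proof.
move=> /X_finP[b ub]; apply/X_finP; exists b => n.
apply: le_trans (ub n.+1); rewrite [leRHS]/u_ /= /pullback raddf_sum.
by rewrite (bigD1 i)//= lerDl sumr_ge0// => j _; exact: u_ge0.
Qed.

Lemma X_fin_phi_word w s : X_fin phi K s -> X_fin phi K (phi_word phi w s).
Proof. by elim: w s => //= i w IH s sfin; exact/IH/X_fin_phi. Qed.

Lemma u_is_cvg s : X_fin phi K s -> cvgn (fun n => u_ phi K n s).
Proof.
move=> /X_finP[b ub]; apply: nondecreasing_is_cvgn; first exact: u_nondecreasing.
by exists b => _ [n _ <-].
Qed.

(** The shared half of the convergence of the real and imaginary parts: a
    monotone sequence bounded by [2 (u_n s + u_n t)], from which the convergent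
    part [u_n s + u_n t] is subtracted. *)
Lemma polarized_is_cvg (x : nat -> R) s t : X_fin phi K s -> X_fin phi K t ->
  (forall n, 2 * x n <= u_ phi K n s + u_ phi K n t) ->
  nondecreasing_seq (fun n => u_ phi K n s + u_ phi K n t + 2 * x n) ->
  cvgn x.
Proof.
move=> sfin tfin xle xnd.
have cv : cvgn (fun n => u_ phi K n s + u_ phi K n t + 2 * x n).
  apply: nondecreasing_is_cvgn => //.
  have [/X_finP[a ua] /X_finP[b ub]] := (sfin, tfin).
  exists (2 * (a + b)) => _ [n _ <-].
  by have := (xle n, ua n, ub n) => -[[? ?] ?]; lra.
have -> : x = fun n => 2^-1 * ((u_ phi K n s + u_ phi K n t + 2 * x n)
                              - (u_ phi K n s + u_ phi K n t)).
  by apply/funext => n; field.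
apply: is_cvgM; first exact: is_cvg_cst.
by apply: is_cvgB => //; apply: is_cvgD; exact: u_is_cvg.
Qed.

(** This is what makes [K_infty], defined by a total limit operator, a genuine
    limit. *)
Lemma iterK_cvg_K_infty s t : X_fin phi K s -> X_fin phi K t ->
  (Kn n s t) @[n --> \oo] --> K_infty phi K s t.
Proof.
move=> sfin tfin.
suff [l Kl] : exists l : R[i], (Kn n s t) @[n --> \oo] --> l.
  by rewrite /K_infty (cvg_lim (@norm_hausdorff _ _) Kl).
(* The form of [Kn n] at (1, -1) bounds the real part and that of the increment
   at (1, 1) gives the monotonicity; (1, i) and (1, -i) do the same for the
   imaginary part. *)
have cr : cvgn (fun n => complex.Re (Kn n s t)).
  apply: polarized_is_cvg sfin tfin _ _ => [n|].
    have := posdef_real_form s t 1 0 (-1) 0 (iterK_posdef n); rewrite /u_; lra.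
  apply/nondecreasing_seqP => n.
  have := posdef_real_form s t 1 0 1 0 (iterK_le_succ n); rewrite /u_ !raddfB.
  lra.
have ci : cvgn (fun n => complex.Im (Kn n s t)).
  apply: polarized_is_cvg sfin tfin _ _ => [n|].
    have := posdef_real_form s t 1 0 0 1 (iterK_posdef n); rewrite /u_; lra.
  apply/nondecreasing_seqP => n.
  have := posdef_real_form s t 1 0 0 (-1) (iterK_le_succ n); rewrite /u_ !raddfB.
  lra.
by exists (limn (fun n => complex.Re (Kn n s t)) +i*
           limn (fun n => complex.Im (Kn n s t)))%C; apply/cvg_ReImP.
Qed.

Lemma K_infty_cauchy_schwarz s t : X_fin phi K s -> X_fin phi K t ->
  re_cauchy_schwarz (K_infty phi K s s) (K_infty phi K s t) (K_infty phi K t t).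
Proof.
move=> sfin tfin.
apply: (re_cauchy_schwarz_cvg (u := fun n => Kn n s s)
  (v := fun n => Kn n s t) (w := fun n => Kn n t t));
  try exact: iterK_cvg_K_infty.
by move=> n; exact/posdef_cauchy_schwarz/iterK_posdef.
Qed.

Lemma M_cauchy_schwarz n s t w : X_fin phi K s -> X_fin phi K t ->
  re_cauchy_schwarz (M_ phi K n s s w) (M_ phi K n s t w) (M_ phi K n t t w).
Proof.
move=> sfin tfin; rewrite /re_cauchy_schwarz /M_.
have -> : p.+1%:R ^+ n = ((p.+1%:R ^+ n)%:C)%C :> R[i].
  by rewrite rmorphXn rmorph_nat.
have := K_infty_cauchy_schwarz (X_fin_phi_word (prefix_word w n) sfin)
                               (X_fin_phi_word (prefix_word w n) tfin).
rewrite /re_cauchy_schwarz.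
set a := K_infty _ _ _ _; set b := K_infty _ _ _ _; set c := K_infty _ _ _ _.
set m := p.+1%:R ^+ n.
have reM z : complex.Re ((m%:C)%C * z) = m * complex.Re z.
  by case: z => x y /=; rewrite mul0r subr0.
have imM z : complex.Im ((m%:C)%C * z) = m * complex.Im z.
  by case: z => x y /=; rewrite mul0r addr0.
rewrite !reM !imM !exprMn -mulrDr mulrACA -expr2.
by apply: ler_wpM2l; exact: sqr_ge0.
Qed.
End Iterates.

(** * The boundary kernel *)

Theorem corollary6p4 (R : realType) (X : Type) (p : nat)
    (phi : 'I_p.+1 -> X -> X) (K : X -> X -> R[i])
    (K_posdef : kernel_posdef K)
    (K_subinvariant : kernel_le K (pullback phi K))
    (mu : probability (Omega p) R) (mu_iid : coordinates_iid_uniform mu)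
    (M_infty : X -> X -> Omega p -> R[i])
    (M_infty_limit : is_M_infty phi K mu M_infty)
    (s t : X) (hs : X_2 phi K s) (ht : X_2 phi K t) :
  exists N : set (Omega p),
    [/\ measurable N, mu N = 0%E &
        forall w : Omega p, ~ N w ->
          `|M_infty s t w| ^+ 2 <=
          diag_factor M_infty s w * diag_factor M_infty t w].
Proof.
have [M_lim M_ge0] := M_infty_limit.
have [_ _ ss] := M_lim s s hs hs.
have [_ _ st] := M_lim s t hs ht.
have [_ _ tt] := M_lim t t ht ht.
have [N [mN N0 subN]] := filterI (filterI ss st) tt.
exists N; split=> // w Nw.
have [[ssw stw] ttw] : ((M_ phi K n s s w @[n --> \oo] --> M_infty s s w) /\
   (M_ phi K n s t w @[n --> \oo] --> M_infty s t w)) /\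
   (M_ phi K n t t w @[n --> \oo] --> M_infty t t w).
  by apply: contrapT => nw; exact/Nw/subN.
have cs := re_cauchy_schwarz_cvg ssw stw ttw (fun n =>
  M_cauchy_schwarz K_posdef K_subinvariant n w hs.1 ht.1).
(* The diagonal entries are nonnegative, hence equal to their real parts, and
   the inequality becomes one between reals. *)
rewrite -add_Re2_Im2 /diag_factor.
rewrite -[M_infty s s w]RRe_real ?ger0_real ?M_ge0//.
rewrite -[M_infty t t w]RRe_real ?ger0_real ?M_ge0//.
by rewrite -rmorphM lecR.
Qed.
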